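(* There is a deterministic algorithm that solves the Unbounded Knapsack problem in time $O(M^2\log T)$, where $M$ is the maximum item weight and $T$ is the capacity.
   Context: Unbounded Knapsack: given $N$ items with weights $w_1,\dots,w_N\in\{1,\dots,M\}$ and values $v_1,\dots,v_N$, and an integer capacity $T$, find a multiset $S$ of items (each item may be chosen any number of times) with total weight at most $T$ maximizing the total value (the algorithm outputs this maximum value).
   Formalization: The time proved is O(max(N+1, M^2(floor(log2 T)+1))): reading N items is charged, since with M=1, T=2 and N items of weight 1 every value must be inspected, so no bound free of N holds; log T is taken as the bit length of T so that T=0,1 make sense. *)

(* Defs.v *)
From HB Require Import structures.
From mathcomp Require Import all_boot all_order all_algebra.

Set Implicit Arguments.
Unset Strict Implicit.
Unset Printing Implicit Defensive.

Import Order.TTheory GRing.Theory Num.Theory.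

Local Open Scope ring_scope.

(** * Unbounded knapsack

    A multiset of items is its multiplicity function [m : 'I_N -> nat]. *)

Section Knapsack.
Variables (R : realDomainType) (N : nat).
Variables (w : 'I_N -> nat) (v : 'I_N -> R) (T : nat).

Definition total_weight (m : 'I_N -> nat) : nat := (\sum_(i < N) m i * w i)%N.

Definition total_value (m : 'I_N -> nat) : R := \sum_(i < N) v i *+ m i.

Definition knapsack_max (x : R) : Prop :=
  (exists2 m, (total_weight m <= T)%N & total_value m = x) /\
  (forall m, (total_weight m <= T)%N -> total_value m <= x).

Definition max_weight : nat := (\max_(i < N) w i)%N.

End Knapsack.

(** * The machine: a word RAM with black-box values

    Programs are deterministic while-programs over random-access memory.  The
    memory has two sorts of cells: words, i.e. natural numbers below a bound
    [B] (word length [log2 B]), used for weights, capacities, counters and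
    addresses; and values, elements of an ordered domain [R], which programs
    can only copy, add and compare.  Values have no constants other than 0 and
    cannot be converted to words, so a program is independent of [R].

    Each sort of memory is a family of arrays named by natural numbers.  Array
    names are literals of the program text (so a program uses finitely many
    arrays) whereas the index into an array is computed; a scalar variable is
    the cell 0 of an array. *)

Inductive wop := Add | Sub | Mul | Div.

Inductive wexp :=
  | WConst of nat
  | WGet of nat & wexp
  | WOp of wop & wexp & wexp.

Inductive vexp :=
  | VZero
  | VGet of nat & wexp
  | VAdd of vexp & vexp.

Inductive test :=
  | WLt of wexp & wexp
  | WEq of wexp & wexp
  | VLt of vexp & vexp
  | Not of test
  | And of test & test.

Inductive cmd :=
  | Skip
  | WSet of nat & wexp & wexp
  | VSet of nat & wexp & vexp
  | Seq of cmd & cmd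
  | If of test & cmd & cmd
  | While of test & cmd.

(** Time is one unit per node of an evaluated expression or test, and one unit
    per executed command. *)

Fixpoint wcost (e : wexp) : nat :=
  match e with
  | WConst _ => 1
  | WGet _ i => (wcost i).+1
  | WOp _ e1 e2 => (wcost e1 + wcost e2).+1
  end.

Fixpoint vcost (e : vexp) : nat :=
  match e with
  | VZero => 1
  | VGet _ i => (wcost i).+1
  | VAdd e1 e2 => (vcost e1 + vcost e2).+1
  end.

Fixpoint tcost (b : test) : nat :=
  match b with
  | WLt e1 e2 | WEq e1 e2 => (wcost e1 + wcost e2).+1
  | VLt e1 e2 => (vcost e1 + vcost e2).+1
  | Not b1 => (tcost b1).+1
  | And b1 b2 => (tcost b1 + tcost b2).+1
  end.

Section Semantics.
Variable R : realDomainType.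

Record state := State { wmem : nat -> nat -> nat; vmem : nat -> nat -> R }.

Definition upd (A : Type) (f : nat -> nat -> A) (a i : nat) (x : A) :=
  fun a' i' => if (a' == a) && (i' == i) then x else f a' i'.

Variable B : nat.

Definition word (n : nat) : option nat := if (n < B)%N then Some n else None.

(** Subtraction is truncated and division by zero yields zero. *)
Definition wop_fun (o : wop) : nat -> nat -> nat :=
  match o with Add => addn | Sub => subn | Mul => muln | Div => divn end.

(** [None] is a word overflow, on which the machine gets stuck. *)
Fixpoint weval (s : state) (e : wexp) : option nat :=
  match e with
  | WConst n => word n
  | WGet a i => if weval s i is Some x then Some (wmem s a x) else None
  | WOp o e1 e2 =>
      match weval s e1, weval s e2 with
      | Some x, Some y => word (wop_fun o x y)
      | _, _ => None
      end
  end.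

Fixpoint veval (s : state) (e : vexp) : option R :=
  match e with
  | VZero => Some 0
  | VGet a i => if weval s i is Some x then Some (vmem s a x) else None
  | VAdd e1 e2 =>
      match veval s e1, veval s e2 with
      | Some x, Some y => Some (x + y)
      | _, _ => None
      end
  end.

Fixpoint teval (s : state) (b : test) : option bool :=
  match b with
  | WLt e1 e2 =>
      match weval s e1, weval s e2 with
      | Some x, Some y => Some (x < y)%N
      | _, _ => None
      end
  | WEq e1 e2 =>
      match weval s e1, weval s e2 with
      | Some x, Some y => Some (x == y)
      | _, _ => None
      end
  | VLt e1 e2 =>
      match veval s e1, veval s e2 with
      | Some x, Some y => Some (x < y)
      | _, _ => None
      end
  | Not b1 => omap negb (teval s b1)
  | And b1 b2 =>
      match teval s b1, teval s b2 with
      | Some x, Some y => Some (x && y)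
      | _, _ => None
      end
  end.

(** [exec s p s' t]: started in [s], the program [p] halts in [s'] after
    exactly [t] units of time, without word overflow. *)
Inductive exec : state -> cmd -> state -> nat -> Prop :=
  | ExecSkip s : exec s Skip s 1
  | ExecWSet s a i e x y :
      weval s i = Some x -> weval s e = Some y ->
      exec s (WSet a i e) (State (upd (wmem s) a x y) (vmem s))
        (wcost i + wcost e).+1
  | ExecVSet s a i e x y :
      weval s i = Some x -> veval s e = Some y ->
      exec s (VSet a i e) (State (wmem s) (upd (vmem s) a x y))
        (wcost i + vcost e).+1
  | ExecSeq s1 s2 s3 p q t u :
      exec s1 p s2 t -> exec s2 q s3 u -> exec s1 (Seq p q) s3 (t + u).+1
  | ExecIf s s' b (c : bool) p q t :
      teval s b = Some c -> exec s (if c then p else q) s' t ->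
      exec s (If b p q) s' (tcost b + t).+1
  | ExecWhileFalse s b p :
      teval s b = Some false -> exec s (While b p) s (tcost b).+1
  | ExecWhileTrue s1 s2 s3 b p t u :
      teval s1 b = Some true -> exec s1 p s2 t -> exec s2 (While b p) s3 u ->
      exec s1 (While b p) s3 (tcost b + t + u).+1.

Lemma exec_deterministic s p s1 t1 s2 t2 :
  exec s p s1 t1 -> exec s p s2 t2 -> s1 = s2 /\ t1 = t2.
Proof.
move=> H; elim: H s2 t2 => {s p s1 t1}.
- by move=> s s2 t2 H; inversion H.
- by move=> s a i e x y Hx Hy s2 t2 H; inversion H; subst; split=> //; congruence.
- by move=> s a i e x y Hx Hy s2 t2 H; inversion H; subst; split=> //; congruence.
- move=> s1 s2 s3 p q t u _ IH1 _ IH2 s4 t4 H; inversion H; subst.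
  by case: (IH1 _ _ H3) => ? ?; subst; case: (IH2 _ _ H6) => -> ->.
- move=> s s' b c p q t Hb _ IH s2 t2 H; inversion H; subst.
  have E : c0 = c by congruence.
  by subst; case: (IH _ _ H7) => -> ->.
- by move=> s b p Hb s2 t2 H; inversion H; subst => //; congruence.
- move=> s1 s2 s3 b p t u Hb _ IH1 _ IH2 s4 t4 H; inversion H; subst.
    by congruence.
  by case: (IH1 _ _ H4) => ? ?; subst; case: (IH2 _ _ H7) => -> ->.
Qed.

End Semantics.

(** * Input and output conventions

    Word array 0 holds [N] and word array 1 holds [T] (at index 0); word
    array 2 holds the weights and value array 0 the values, at indices
    [0, ..., N-1]; all other cells are zero.  The output is cell 0 of value
    array 1.  The maximum weight is not given to the program. *)

Definition to_array (A : Type) (x0 : A) (N : nat) (f : 'I_N -> A) (i : nat) : A :=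
  if insub i is Some j then f j else x0.

Definition input (R : realDomainType) (N : nat) (w : 'I_N -> nat)
    (v : 'I_N -> R) (T : nat) : state R :=
  State
    (fun a i => match a with
                | 0 => if i == 0%N then N else 0%N
                | 1 => if i == 0%N then T else 0%N
                | 2 => to_array 0%N w i
                | _ => 0%N
                end)
    (fun a i => if a == 0%N then to_array 0 v i else 0).

Definition output (R : realDomainType) (s : state R) : R := vmem s 1 0.

(* Main.v *)
(** An optimal multiset of weight at most [t] splits, by greedy balancing, into
    two parts that fit into capacities [a] and [t - a] differing by at most the
    maximum weight [M].  Hence the optimal values at all capacities within
    [2 * M] of [T / 2 ^ k] follow, in time O(M^2), from those within [2 * M] of
    [T / 2 ^ k.+1]; the values around [0] come from the textbook recurrence that
    removes one item.

    A single table, indexed by the capacity itself, serves all levels: its cells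
    start at 0, only increase, and always hold a value that is attainable within
    their capacity, so a cell never changes once it is optimal and no window has
    to be copied or reset.  For the same reason an absent weight needs no flag:
    it acts as an item of value 0. *)
Require Import Defs.
From HB Require Import structures.
From mathcomp Require Import all_boot all_order all_algebra.
From mathcomp Require Import zify ring.
Import Order.TTheory GRing.Theory Num.Theory.

Set Implicit Arguments.
Unset Strict Implicit.
Unset Printing Implicit Defensive.

Section Logic.
Variables (R : realDomainType) (B : nat).
Implicit Types (s : state R) (Q : state R -> Prop).

Fixpoint wden s (e : wexp) : nat :=
  match e with
  | WConst n => n
  | WGet a i => wmem s a (wden s i)
  | WOp o e1 e2 => wop_fun o (wden s e1) (wden s e2)
  end.

Fixpoint wok s (e : wexp) : bool :=
  match e with
  | WConst n => n < B
  | WGet _ i => wok s i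
  | WOp o e1 e2 =>
      [&& wok s e1, wok s e2 & wop_fun o (wden s e1) (wden s e2) < B]
  end.

Lemma weval_ok s e : wok s e -> weval B s e = Some (wden s e).
Proof.
elim: e => [n|a i IH|o e1 IH1 e2 IH2] /=; first by rewrite /word => ->.
  by move=> /IH ->.
by case/and3P=> /IH1 -> /IH2 -> lt_B; rewrite /word lt_B.
Qed.

Fixpoint vden s (e : vexp) : R :=
  match e with
  | VZero => 0%R
  | VGet a i => vmem s a (wden s i)
  | VAdd e1 e2 => (vden s e1 + vden s e2)%R
  end.

Fixpoint vok s (e : vexp) : bool :=
  match e with
  | VZero => true
  | VGet _ i => wok s i
  | VAdd e1 e2 => vok s e1 && vok s e2
  end.

Lemma veval_ok s e : vok s e -> veval B s e = Some (vden s e).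
Proof.
elim: e => [|a i|e1 IH1 e2 IH2] //=; first by move=> /weval_ok ->.
by case/andP=> /IH1 -> /IH2 ->.
Qed.

Fixpoint tden s (b : test) : bool :=
  match b with
  | WLt e1 e2 => wden s e1 < wden s e2
  | WEq e1 e2 => wden s e1 == wden s e2
  | VLt e1 e2 => (vden s e1 < vden s e2)%R
  | Not b1 => ~~ tden s b1
  | And b1 b2 => tden s b1 && tden s b2
  end.

Fixpoint tok s (b : test) : bool :=
  match b with
  | WLt e1 e2 | WEq e1 e2 => wok s e1 && wok s e2
  | VLt e1 e2 => vok s e1 && vok s e2
  | Not b1 => tok s b1
  | And b1 b2 => tok s b1 && tok s b2
  end.

Lemma teval_ok s b : tok s b -> teval B s b = Some (tden s b).
Proof.
elim: b => [e1 e2|e1 e2|e1 e2|b IH|b1 IH1 b2 IH2] /=.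
- by case/andP=> /weval_ok -> /weval_ok ->.
- by case/andP=> /weval_ok -> /weval_ok ->.
- by case/andP=> /veval_ok -> /veval_ok ->.
- by move=> /IH ->.
- by case/andP=> /IH1 -> /IH2 ->.
Qed.

Definition runs s c Q (n : nat) : Prop :=
  exists s' t, [/\ exec B s c s' t, Q s' & t <= n].

Lemma runs_weaken s c Q Q' n n' :
  runs s c Q n -> (forall s', Q s' -> Q' s') -> n <= n' -> runs s c Q' n'.
Proof.
case=> s' [t [run_c Q_s' le_tn]] QQ' le_nn'; exists s', t.
by split=> //; [apply: QQ' | apply: leq_trans le_nn'].
Qed.

Lemma runs_seq s p q Q n m :
  runs s p (fun s' => runs s' q Q m) n -> runs s (Seq p q) Q (n + m).+1.
Proof.
case=> s1 [t [run_p [s2 [u [run_q Q_s2 le_um]]] le_tn]].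
exists s2, (t + u).+1; split=> //; first exact: ExecSeq run_p run_q.
by rewrite ltnS leq_add.
Qed.

(** Only for loop-free commands: [While] gets junk values here and in [cost]. *)
Fixpoint wp s (c : cmd) Q : Prop :=
  match c with
  | Skip => Q s
  | WSet a i e =>
      wok s i && wok s e /\
      Q (State (upd (wmem s) a (wden s i) (wden s e)) (vmem s))
  | VSet a i e =>
      wok s i && vok s e /\
      Q (State (wmem s) (upd (vmem s) a (wden s i) (vden s e)))
  | Seq p q => wp s p (fun s' => wp s' q Q)
  | If b p q => tok s b /\ if tden s b then wp s p Q else wp s q Q
  | While _ _ => False
  end.

Fixpoint cost (c : cmd) : nat :=
  match c with
  | Skip => 1
  | WSet _ i e => (wcost i + wcost e).+1
  | VSet _ i e => (wcost i + vcost e).+1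
  | Seq p q => (cost p + cost q).+1
  | If b p q => (tcost b + maxn (cost p) (cost q)).+1
  | While _ _ => 0
  end.

Lemma runs_if s b p q Q n :
  tok s b -> runs s (if tden s b then p else q) Q n ->
  runs s (If b p q) Q (tcost b + n).+1.
Proof.
move=> ok_b [s' [t [run_c Q_s' le_tn]]]; exists s', (tcost b + t).+1.
by split=> //; [apply: ExecIf (teval_ok ok_b) run_c | rewrite ltnS leq_add2l].
Qed.

Lemma runs_wp s c Q : wp s c Q -> runs s c Q (cost c).
Proof.
elim: c s Q => [|a i e|a i e|p IHp q IHq|b p IHp q IHq|b p _] s Q //=.
- by move=> Q_s; exists s, 1; split=> //; apply: ExecSkip.
- case=> /andP[ok_i ok_e] Q_s; eexists _, _; split; last exact: leqnn.
    by apply: ExecWSet; apply: weval_ok.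
  exact: Q_s.
- case=> /andP[ok_i ok_e] Q_s; eexists _, _; split; last exact: leqnn.
    by apply: ExecVSet; [apply: weval_ok | apply: veval_ok].
  exact: Q_s.
- move=> /IHp run_p; apply: runs_seq; apply: runs_weaken run_p _ (leqnn _).
  by move=> s' /IHq.
- case=> ok_b wp_pq; apply: runs_if ok_b _.
  case: (tden s b) wp_pq => [/IHp|/IHq] run_pq;
    apply: runs_weaken run_pq _ _ => //; [exact: leq_maxl | exact: leq_maxr].
Qed.

Lemma runs_for (I : nat -> state R -> Prop) lo hi b p n s :
    (forall i s', lo <= i <= hi -> I i s' ->
       tok s' b /\ tden s' b = (i < hi)) ->
    (forall i s', lo <= i < hi -> I i s' -> runs s' p (I i.+1) n) ->
    lo <= hi -> I lo s ->
  runs s (While b p) (I hi) ((hi - lo).+1 * (n + tcost b).+1).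
Proof.
move=> test_b body le_lohi.
have [k def_k] : {k | k = hi - lo} by exists (hi - lo).
rewrite -def_k; elim: k lo s def_k le_lohi test_b body.
  move=> lo s def_k le_lohi test_b _ I_s.
  have /eqP <- : lo == hi by rewrite eqn_leq le_lohi -subn_eq0 -def_k.
  have [|ok_b den_b] := test_b lo s _ I_s; first by rewrite leqnn le_lohi.
  exists s, (tcost b).+1; split=> //; last by rewrite mul1n ltnS leq_addl.
  by apply: ExecWhileFalse; rewrite teval_ok // den_b -subn_gt0 -def_k.
move=> k IHk lo s def_k le_lohi test_b body I_s.
have lt_lohi : lo < hi by rewrite -subn_gt0 -def_k.
have [|ok_b den_b] := test_b lo s _ I_s; first by rewrite leqnn le_lohi.
have [|s1 [t [run_p I_s1 le_tn]]] := body lo s _ I_s; first by rewrite leqnn.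
have [|||||s2 [u [run_w I_s2 le_uk]]] := IHk lo.+1 s1 => //.
- by rewrite subnS -def_k.
- by move=> i s' /andP[/ltnW le_loi le_ihi]; apply: test_b; rewrite le_loi.
- by move=> i s' /andP[/ltnW le_loi le_ihi]; apply: body; rewrite le_loi.
exists s2, (tcost b + t + u).+1; split=> //; last by lia.
by apply: ExecWhileTrue run_p run_w; rewrite teval_ok // den_b lt_lohi.
Qed.

End Logic.

Section Tables.
Variables (R : realDomainType) (N : nat) (w : 'I_N -> nat) (v : 'I_N -> R).
Hypothesis w_gt0 : forall i, 0 < w i.
Local Notation M := (max_weight w).
Local Notation wt := (total_weight w).
Local Notation val := (total_value v).
Implicit Types (F : nat -> R) (m : 'I_N -> nat) (t a : nat).

Definition feasible t (x : R) := exists2 m, wt m <= t & val m = x.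
Definition dominates t (x : R) := forall m, wt m <= t -> (val m <= x)%R.

Definition single (i : 'I_N) : 'I_N -> nat := fun j => j == i.

Lemma total_weightD m1 m2 : wt (fun i => m1 i + m2 i) = wt m1 + wt m2.
Proof. by rewrite -big_split; apply: eq_bigr => i _; rewrite mulnDl. Qed.

Lemma total_valueD m1 m2 : (val (fun i => (m1 i + m2 i)%N) = val m1 + val m2)%R.
Proof. by rewrite -big_split; apply: eq_bigr => i _; rewrite mulrnDr. Qed.

Lemma total_weight_single i : wt (single i) = w i.
Proof.
rewrite /total_weight (bigD1 i) //= /single eqxx mul1n big1 ?addn0 // => j.
by move=> /negbTE ->.
Qed.

Lemma total_value_single i : val (single i) = v i.
Proof.
rewrite /total_value (bigD1 i) //= /single eqxx mulr1n big1 ?addr0 // => j.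
by move=> /negbTE ->; rewrite mulr0n.
Qed.

Lemma leq_max_weight i : w i <= M.
Proof. exact: leq_bigmax. Qed.

Lemma max_weight_gt0 : 0 < N -> 0 < M.
Proof. by move=> N_gt0; apply: leq_trans (leq_max_weight (Ordinal N_gt0)). Qed.

Lemma multisetP m : (forall i, m i = 0) \/
  exists i m', [/\ wt m = wt (single i) + wt m',
    (val m = val (single i) + val m')%R & \sum_i m' i < \sum_i m i].
Proof.
have [/forallP m0|/forallPn[i m_i]] := boolP [forall i, m i == 0].
  by left=> i; apply/eqP.
right; exists i, (fun j => m j - single i j).
have m_split j : m j = single i j + (m j - single i j).
  by rewrite subnKC // /single; case: eqP => // ->; rewrite lt0n.
split; rewrite -?total_weightD -?total_valueD.
- by apply: eq_bigr => j _; rewrite -m_split.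
- by apply: eq_bigr => j _; rewrite -m_split.
rewrite [ltnRHS](eq_bigr _ (fun j _ => m_split j)) big_split /=.
rewrite -[ltnLHS]add0n ltn_add2r (bigD1 i) //= /single eqxx; lia.
Qed.

Lemma empty_weight m : (forall i, m i = 0) -> wt m = 0.
Proof. by move=> m0; apply: big1 => i _; rewrite m0. Qed.

Lemma empty_value m : (forall i, m i = 0) -> val m = 0%R.
Proof. by move=> m0; apply: big1 => i _; rewrite m0 mulr0n. Qed.

(** Greedy balancing: each item goes to the lighter side. *)
Lemma balanced_split m : exists m1 m2,
  [/\ wt m = wt m1 + wt m2, (val m = val m1 + val m2)%R
    & wt m1 <= wt m2 <= wt m1 + M].
Proof.
have [n le_mn] := ubnP (\sum_i m i); elim: n m le_mn => // n IHn m le_mn.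
have [m0|[i [m' [-> -> lt_m'm]]]] := multisetP m.
  exists m, m; rewrite empty_weight // empty_value //.
  by rewrite addr0 leqnn leq0n.
have [|m1 [m2 [-> -> /andP[le_m12 le_m21]]]] := IHn m'.
  exact: leq_trans lt_m'm le_mn.
pose m1i j := single i j + m1 j.
have wt1i : wt m1i = w i + wt m1 by rewrite total_weightD total_weight_single.
have val1i : val m1i = (val (single i) + val m1)%R by rewrite total_valueD.
have le_wiM := leq_max_weight i.
have [le_m1i|lt_m1i] := leqP (wt m1i) (wt m2).
  exists m1i, m2; rewrite wt1i val1i total_weight_single addnA addrA.
  by split=> //; lia.
exists m2, m1i; rewrite wt1i val1i total_weight_single; split=> //.
- lia.
- by rewrite addrA addrC.
- lia.
Qed.

Definition sound F := forall t, feasible t (F t).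

Definition seeded F := (forall t, 0 <= F t)%R /\ forall i, (v i <= F (w i))%R.

Lemma feasibleD a b x y :
  feasible a x -> feasible b y -> feasible (a + b) (x + y)%R.
Proof.
case=> m1 le_m1a <- [m2 le_m2b <-]; exists (fun i => m1 i + m2 i).
  by rewrite total_weightD leq_add.
exact: total_valueD.
Qed.

Definition splits F t lo := forall m, wt m <= t -> exists a,
  [/\ lo <= a <= lo + M, a <= t & (val m <= F a + F (t - a)%N)%R].

Lemma splits_first_item F t : seeded F ->
  (forall u, u < t -> dominates u (F u)) -> splits F t 0.
Proof.
case=> F_ge0 F_item dom_F m le_mt.
have [m0|[i [m' [wt_m -> _]]]] := multisetP m.
  by exists 0; rewrite empty_value // addr_ge0.
rewrite total_value_single; rewrite wt_m total_weight_single in le_mt.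
exists (w i); rewrite leq_max_weight; split=> //; first by lia.
by rewrite lerD // dom_F //; have := w_gt0 i; lia.
Qed.

Lemma splits_balanced F c t : 0 < M ->
    c - 2 * M <= t <= c + 2 * M ->
    (forall u, c %/ 2 - 2 * M <= u <= c %/ 2 + 2 * M -> dominates u (F u)) ->
  splits F t ((t - M) %/ 2).
Proof.
move=> M_gt0 t_win dom_F m le_mt.
have [m1 [m2 [wt_m -> /andP[le_m12 le_m21]]]] := balanced_split m.
exists (minn (t %/ 2) (t - wt m2)).
split; try lia.
by apply: lerD; apply: dom_F; lia.
Qed.

End Tables.

(** Word arrays 3 to 6 are the registers [M], [p] (a power of 2), [t] (a
    capacity; during input an item index) and [j]; value array 2 is the
    table.  Before [p] is set its register holds an irrelevant value. *)
Definition nE := WGet 0 (WConst 0).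
Definition capE := WGet 1 (WConst 0).
Definition mE := WGet 3 (WConst 0).
Definition pE := WGet 4 (WConst 0).
Definition tE := WGet 5 (WConst 0).
Definition jE := WGet 6 (WConst 0).
Definition setreg r e := WSet r (WConst 0) e.
Definition incr r := setreg r (WOp Add (WGet r (WConst 0)) (WConst 1)).

(** The guard matters: subtraction being truncated, [a > t] would add the cells
    [a] and [0]. *)
Definition relax (a : wexp) : cmd :=
  let sum := VAdd (VGet 2 a) (VGet 2 (WOp Defs.Sub tE a)) in
  If (And (Not (WLt tE a)) (VLt (VGet 2 tE) sum)) (VSet 2 tE sum) Skip.

Definition scan_body (e : wexp) : cmd := Seq (relax (WOp Add e jE)) (incr 6).
Definition scan_test : test := WLt jE (WOp Add mE (WConst 1)).
Definition scan (e : wexp) : cmd :=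
  Seq (setreg 6 (WConst 0)) (While scan_test (scan_body e)).

Definition centerE := WOp Div capE pE.
Definition radiusE := WOp Mul (WConst 2) mE.
Definition window_test : test :=
  WLt tE (WOp Add (WOp Add centerE radiusE) (WConst 1)).
Definition window (e : wexp) : cmd :=
  Seq (setreg 5 (WOp Defs.Sub centerE radiusE))
    (While window_test (Seq (scan e) (incr 5))).

Definition read_body : cmd :=
  let wE := WGet 2 tE in
  Seq (If (WLt mE wE) (setreg 3 wE) Skip)
    (Seq (If (VLt (VGet 2 wE) (VGet 0 tE)) (VSet 2 wE (VGet 0 tE)) Skip)
       (incr 5)).
Definition read : cmd := While (WLt tE nE) read_body.

Definition double_test : test := Not (WLt capE pE).
Definition double_body : cmd := setreg 4 (WOp Mul (WConst 2) pE).
Definition double : cmd :=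
  Seq (setreg 4 (WConst 1)) (While double_test double_body).

Definition halfE := WOp Div (WOp Defs.Sub tE mE) (WConst 2).
Definition descend_test : test := WLt (WConst 1) pE.
Definition descend_body : cmd :=
  Seq (setreg 4 (WOp Div pE (WConst 2))) (window halfE).
Definition descend : cmd := While descend_test descend_body.

Definition knapsack : cmd :=
  If (WLt (WConst 0) nE)
    (Seq read (Seq double (Seq (window (WConst 0))
      (Seq descend (VSet 1 (WConst 0) (VGet 2 capE))))))
    Skip.

Section Correctness.
Variables (R : realDomainType) (N : nat) (w : 'I_N -> nat) (v : 'I_N -> R).
Variables (T B : nat).
Hypotheses (w_gt0 : forall i, 0 < w i) (N_gt0 : 0 < N).
Local Notation M := (max_weight w).
Hypothesis leB : 8 * (N + M + T + 2) <= B.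
Implicit Types (F : nat -> R) (s : state R).

Let M_gt0 : 0 < M := max_weight_gt0 w_gt0 N_gt0.

Record regs s p t : Prop := Regs {
  reg_cap : wmem s 1 0 = T;
  reg_max : wmem s 3 0 = M;
  reg_p : wmem s 4 0 = p;
  reg_t : wmem s 5 0 = t }.

Record above F s : Prop := Above {
  above_sound : sound w v (vmem s 2);
  above_ge : forall u, (F u <= vmem s 2 u)%R }.

Definition bound_expr (e : wexp) (lo : nat -> nat) :=
  forall s p t, regs s p t -> t <= T + 2 * M ->
    [/\ wok B s e, wden s e = lo t & lo t <= t].

Lemma runs_scan F e lo p t s : bound_expr e lo -> t <= T + 2 * M ->
    regs s p t -> above F s ->
  runs B s (scan e)
    (fun s' => [/\ regs s' p t, above F s'
       & forall a, lo t <= a <= lo t + M -> a <= t ->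
           (F a + F (t - a)%N <= vmem s' 2 t)%R])
    (M.+2 * (cost (scan_body e) + 20)).
Proof.
move=> e_lo le_t regs_s above_s.
pose I j s' := [/\ regs s' p t, above F s', wmem s' 6 0 = j
  & forall a, lo t <= a < lo t + j -> a <= t ->
           (F a + F (t - a)%N <= vmem s' 2 t)%R].
have run_loop s0 : I 0 s0 ->
    runs B s0 (While scan_test (scan_body e)) (I M.+1)
      ((M.+1 - 0).+1 * (cost (scan_body e) + tcost scan_test).+1).
  apply: runs_for => // [j s'|j s'] /andP[_ le_j] [regs_s' above_s' j_s' F_s'].
    by case: regs_s' => _ M_s' _ _; rewrite /= !j_s' M_s'; split; lia.
  have [ok_e den_e le_lo] := e_lo _ _ _ regs_s' le_t.
  apply: runs_wp; have [T_s' M_s' p_s' t_s'] := regs_s'.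
  have [F_sound F_le] := above_s'.
  rewrite /= ok_e den_e !t_s' j_s'.
  split; first by lia.
  have step (x : R) : (vmem s' 2 t <= x)%R ->
      (lo t + j <= t ->
         (vmem s' 2 (lo t + j) + vmem s' 2 (t - (lo t + j))%N <= x)%R) ->
    forall a, lo t <= a < lo t + j.+1 -> a <= t -> (F a + F (t - a)%N <= x)%R.
    move=> le_x new_x a /andP[le_a]; rewrite addnS ltnS leq_eqVlt.
    case/orP=> [/eqP def_a|lt_a] le_at; last first.
      by apply: le_trans le_x; apply: F_s'; rewrite ?le_a.
    by rewrite def_a in le_at *; apply: le_trans (new_x le_at); apply: lerD.
  case: ifP => [/andP[le_at lt_F]|no_F] /=.
    split; first by lia.
    split; first by lia.
    split; rewrite ?addn1 //=.
    - split=> //= u; rewrite /upd /=; case: eqP => [->|_ //].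
        have := feasibleD (F_sound (lo t + j)) (F_sound (t - (lo t + j))).
        by rewrite subnKC // leqNgt.
      by apply: le_trans (ltW lt_F).
    - by rewrite /upd /= eqxx; apply: step => //; apply: ltW.
  split; first by lia.
  split; rewrite ?addn1 //=; apply: step => //.
  move=> le_at; rewrite leNgt; apply/negP => lt_F.
  by rewrite lt_F andbT -leqNgt le_at in no_F.
apply: runs_weaken; first apply: runs_seq.
- apply: (@runs_weaken _ _ _ _ (I 0)); first apply: runs_wp.
  + rewrite /=; split; first by lia.
    case: regs_s above_s => [T_s M_s p_s t_s] [F_sound F_le].
    by split=> //= a; lia.
  + by move=> s'; apply: run_loop.
  + exact: leqnn.
- move=> s' [regs_s' above_s' _ F_s']; split=> // a le_a le_at.
  by apply: F_s' => //; lia.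
- by rewrite subn0 /=; nia.
Qed.

Definition table s := sound w v (vmem s 2) /\ seeded w v (vmem s 2).

Definition near p u := T %/ p - 2 * M <= u <= T %/ p + 2 * M.

Definition solved (A : nat -> Prop) s :=
  forall u, A u -> dominates w v u (vmem s 2 u).

Lemma above_table s s' : table s -> above (vmem s 2) s' -> table s'.
Proof.
case=> _ [F_ge0 F_item] [F_sound F_le]; split=> //; split=> [u|i].
  exact: le_trans (F_ge0 u) (F_le u).
exact: le_trans (F_item i) (F_le (w i)).
Qed.

Lemma above_solved A s s' : solved A s -> above (vmem s 2) s' -> solved A s'.
Proof.
move=> dom_A [_ F_le] u /dom_A dom_u m le_mu.
exact: le_trans (dom_u m le_mu) (F_le u).
Qed.

Definition window_cost e := 18 * (cost (scan_body e) + 20) + 500.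

Lemma runs_window A e lo p t0 s : bound_expr e lo ->
    regs s p t0 -> table s -> solved A s ->
    (forall F t, near p t -> seeded w v F ->
       (forall u, A u -> dominates w v u (F u)) ->
       (forall u, u < t -> near p u -> dominates w v u (F u)) ->
     splits w v F t (lo t)) ->
  runs B s (window e)
    (fun s' => exists t, [/\ regs s' p t, table s' & solved (near p) s'])
    (window_cost e * M ^ 2).
Proof.
move=> e_lo regs_s table_s solved_s split_F.
pose c := T %/ p; have le_cT : c <= T by apply: leq_div.
pose I t s' := [/\ regs s' p t, table s', solved A s'
  & solved (fun u => u < t /\ near p u) s'].
have run_loop s0 : I (c - 2 * M) s0 ->
    runs B s0 (While window_test (Seq (scan e) (incr 5)))
      (I (c + 2 * M).+1)
      (((c + 2 * M).+1 - (c - 2 * M)).+1 *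
         ((M.+2 * (cost (scan_body e) + 20) + cost (incr 5)).+1
            + tcost window_test).+1).
  apply: runs_for => [t s'|t s'|]; last by lia.
    case/andP=> le_ct le_tc [[T_s' M_s' p_s' t_s'] _ _ _] /=.
    by rewrite T_s' M_s' p_s' t_s' -/c; split; lia.
  case/andP=> le_ct le_tc [regs_s' table_s' solved_s' done_s'].
  have above_s' : above (vmem s' 2) s' by case: table_s' => sound_s' _; split.
  have le_t : t <= T + 2 * M by lia.
  apply: runs_seq.
  apply: runs_weaken (runs_scan e_lo le_t regs_s' above_s') _ (leqnn _).
  move=> s1 [regs_s1 above_s1 new_s1]; apply: runs_wp.
  case: (regs_s1) => T_s1 M_s1 p_s1 t_s1.
  rewrite /= t_s1 addn1; split; first by lia.
  split=> //.
  - exact: (above_table table_s' above_s1).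
  - exact: (above_solved solved_s' above_s1).
  move=> u [lt_ut near_u] /=.
  have [def_u|neq_ut] := eqVneq u t; last first.
    apply: (above_solved done_s' above_s1); split=> //.
    by rewrite ltn_neqAle neq_ut.
  rewrite def_u in near_u * => m le_mt.
  have [||||a [le_a le_at le_m]] := split_F (vmem s' 2) t _ _ _ _ m le_mt => //.
  - by case: table_s'.
  - by move=> x lt_xt near_x; apply: done_s'.
  exact: le_trans le_m (new_s1 _ le_a le_at).
apply: runs_weaken; first apply: runs_seq.
- apply: (@runs_weaken _ _ _ _ (I (c - 2 * M))); first apply: runs_wp.
  + case: (regs_s) => T_s M_s p_s t_s.
    rewrite /= T_s M_s p_s -/c; split; first by lia.
    by split=> // u [lt_u /andP[le_u _]]; rewrite leqNgt lt_u in le_u.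
  + by move=> s'; apply: run_loop.
  + exact: leqnn.
- move=> s' [regs_s' table_s' _ done_s']; exists (c + 2 * M).+1; split=> //.
  by move=> u near_u; apply: done_s'; split=> //; case/andP: near_u.
- rewrite /window_cost.
  set K := cost (scan_body e); rewrite /=.
  have le_win : ((c + 2 * M).+1 - (c - 2 * M)).+1 <= 6 * M by lia.
  have le_scan : M.+2 * (K + 20) <= 3 * M * (K + 20) by rewrite leq_mul2r; lia.
  have := leq_mul le_win (leq_add le_scan (leqnn 40)).
  have le_MM : M <= M ^ 2 by rewrite leq_pmulr.
  rewrite (_ : 6 * M * _ = 18 * ((K + 20) * M ^ 2) + 240 * M); last first.
    by rewrite expnS expn1; ring.
  move: (M.+2 * _) ((c + _).+1 - _).+1 (M ^ 2) le_MM => n x S le_MM le_xn.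
  have := M_gt0; clear -le_MM le_xn; nia.
Qed.

Lemma to_array_ord (A : Type) (x0 : A) (f : 'I_N -> A) (i : 'I_N) :
  to_array x0 f i = f i.
Proof. by rewrite /to_array valK. Qed.

Definition seen i m F :=
  [/\ m <= M, forall j : 'I_N, j < i -> w j <= m, sound w v F,
      forall u, (0 <= F u)%R & forall j : 'I_N, j < i -> (v j <= F (w j))%R].

Lemma seen_step i m F (j : 'I_N) : i = j -> seen i m F ->
  seen i.+1 (if m < w j then w j else m)
    (fun u => if (F (w j) < v j)%R && (u == w j) then v j else F u).
Proof.
move=> -> [le_mM le_wm F_sound F_ge0 F_item]; split.
- by case: ifP => // _; apply: leq_max_weight.
- move=> j'; rewrite ltnS leq_eqVlt => /orP[/eqP/val_inj ->|/le_wm le_w];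
    by case: ifP; lia.
- move=> u; case: ifP => // /andP[_ /eqP ->]; exists (single j).
    by rewrite total_weight_single.
  exact: total_value_single.
- move=> u; case: ifP => // /andP[lt_F _]; apply: ltW.
  exact: le_lt_trans (F_ge0 _) lt_F.
- move=> j'; rewrite ltnS leq_eqVlt => /orP[/eqP/val_inj ->|/F_item le_v].
    by rewrite eqxx andbT; case: ltP.
  case: ifP => // /andP[lt_F /eqP eq_w]; apply: le_trans le_v _.
  by rewrite eq_w ltW.
Qed.

Lemma runs_read :
  runs B (input w v T) read
    (fun s => exists p t, regs s p t /\ table s)
    (N.+1 * (cost read_body + 10)).
Proof.
pose I i s := [/\ wmem s 0 0 = N, wmem s 1 0 = T, wmem s 5 0 = i,
    forall j : 'I_N, wmem s 2 j = w j & forall j : 'I_N, vmem s 0 j = v j]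
  /\ seen i (wmem s 3 0) (vmem s 2).
apply: (@runs_weaken _ _ _ _ (I N) _
  ((N - 0).+1 * (cost read_body + tcost (WLt tE nE)).+1)).
- apply: runs_for => // [i s|i s|] /=.
  + by move=> le_i [[N_s T_s i_s _ _] _]; rewrite N_s i_s; split; lia.
  + move=> lt_i [[N_s T_s i_s w_s v_s] seen_s]; apply: runs_wp.
    have := seen_step (j := Ordinal lt_i) erefl seen_s.
    have := w_s (Ordinal lt_i); have := v_s (Ordinal lt_i).
    have le_w := leq_max_weight w (Ordinal lt_i).
    have le_mM : wmem s 3 0 <= M by case: seen_s.
    set wi := w _; set vi := v _; rewrite /= => v_i w_i seen_S.
    have [B_gt0 B_gt1 lt_iB] : [/\ 0 < B, 1 < B & i + 1 < B] by split; lia.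
    rewrite i_s w_i B_gt0 ?B_gt1; split=> //; move: seen_S.
    case: ltnP => _ seen_S; rewrite /upd /= ?i_s ?w_i ?v_i ?B_gt1.
      do 2!split=> //; move: seen_S.
      case: ltP => _ seen_S; rewrite ?lt_iB addn1; do ?(split=> //=).
    split=> //; move: seen_S.
    case: ltP => _ seen_S; rewrite ?lt_iB addn1; do ?(split=> //=).
  + split; first by split=> // j; rewrite /= to_array_ord.
    split=> //= t; exists (fun=> 0); first by rewrite empty_weight.
    exact: empty_value.
- move=> s [[N_s T_s i_s w_s v_s] [le_mM le_wm F_sound F_ge0 F_item]].
  exists (wmem s 4 0), N; split; split=> //.
    apply/eqP; rewrite eqn_leq le_mM; apply/bigmax_leqP => j _; exact: le_wm.
  by split=> // j; apply: F_item.
- by rewrite subn0 /=; lia.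
Qed.

Definition bits := if T is 0 then 0 else (trunc_log 2 T).+1.

Lemma leq_exp_bits j : (2 ^ j <= T) = (j < bits).
Proof.
rewrite /bits; case: T => [|T']; first by rewrite leqNgt expn_gt0.
rewrite ltnS; apply/idP/idP => [|le_j]; first exact: trunc_log_max.
apply: (@leq_trans (2 ^ trunc_log 2 T'.+1)); first by rewrite leq_exp2l.
exact: trunc_logP.
Qed.

Lemma bits_le : bits <= (trunc_log 2 T).+1.
Proof. by rewrite /bits; case: T. Qed.

Lemma runs_double s p t : regs s p t -> table s ->
  runs B s double (fun s' => regs s' (2 ^ bits) t /\ table s')
    (bits.+1 * 30).
Proof.
move=> regs_s table_s.
pose I i s' := regs s' (2 ^ i) t /\ table s'.
have run_loop s0 : I 0 s0 ->
    runs B s0 (While double_test double_body) (I bits)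
      ((bits - 0).+1 * (cost double_body + tcost double_test).+1).
  apply: runs_for => // i s' /andP[_ le_i] [regs_s' table_s'];
    have [T_s' M_s' p_s' t_s'] := regs_s'.
    by rewrite /= T_s' p_s' -leqNgt leq_exp_bits; split=> //; lia.
  have := leq_exp_bits i; rewrite le_i => le_pT.
  apply: runs_wp; rewrite /= p_s' -expnS; split; last by [].
  by rewrite expnS; lia.
apply: runs_weaken; first apply: runs_seq.
- apply: (@runs_weaken _ _ _ _ (I 0)); first apply: runs_wp.
  + by rewrite /=; split; [lia | case: regs_s].
  + by move=> s'; apply: run_loop.
  + exact: leqnn.
- by [].
- by rewrite subn0 /=; lia.
Qed.

Lemma runs_descend s t : regs s (2 ^ bits) t -> table s ->
    solved (near (2 ^ bits)) s ->
  runs B s descend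
    (fun s' => exists t', [/\ regs s' 1 t', table s' & solved (near 1) s'])
    (bits.+1 * (window_cost halfE * M ^ 2 + 20)).
Proof.
move=> regs_s table_s solved_s.
pose I i s' := exists t', [/\ regs s' (2 ^ (bits - i)) t', table s'
  & solved (near (2 ^ (bits - i))) s'].
apply: (@runs_weaken _ _ _ _ (I bits) _ ((bits - 0).+1 *
  ((cost (setreg 4 (WOp Div pE (WConst 2))) + window_cost halfE * M ^ 2).+1
     + tcost descend_test).+1)).
- apply: runs_for => // [i s'|i s'|].
  + case/andP=> _ le_i [t' [[T_s' M_s' p_s' t_s'] _ _]].
    rewrite /= p_s'; split; first by lia.
    by have := ltn_exp2l 0 (bits - i) (isT : 1 < 2); rewrite expn0 subn_gt0.
  + case/andP=> _ lt_i [t' [regs_s' table_s' solved_s']].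
    have [T_s' M_s' p_s' t_s'] := regs_s'.
    have def_p : 2 ^ (bits - i) = 2 ^ (bits - i.+1) * 2.
      by rewrite -expnSr subnSK.
    have le_p : 2 ^ (bits - i.+1) <= T by rewrite leq_exp_bits; lia.
    apply: runs_seq.
    apply: (@runs_weaken _ _ _ _ (fun s1 => [/\ regs s1 (2 ^ (bits - i.+1)) t',
      table s1 & solved (near (2 ^ (bits - i))) s1])); first apply: runs_wp.
    * rewrite /= p_s' def_p mulnK //; split; first by lia.
      by split=> //; rewrite -?def_p.
    * move=> s1 [regs_s1 table_s1 solved_s1].
      apply: runs_window regs_s1 table_s1 solved_s1 _.
        move=> s2 p2 t2 [T_s2 M_s2 p_s2 t_s2] le_t2; rewrite /= t_s2 M_s2.
        by split; [lia | exact: erefl | lia].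
      move=> F u near_u _ dom_F _; apply: splits_balanced M_gt0 near_u _.
      by move=> x; rewrite -divnMA -def_p; apply: dom_F.
    * exact: leqnn.
  + by exists t; rewrite subn0.
- by move=> s'; rewrite /I subnn.
- by rewrite subn0 /= leq_mul2l; lia.
Qed.

Lemma runs_knapsack :
  runs B (input w v T) knapsack (fun s => knapsack_max w v T (output s))
    ((cost read_body + 200 + window_cost (WConst 0) + 2 * window_cost halfE)
       * maxn N.+1 (M ^ 2 * (trunc_log 2 T).+1)).
Proof.
have run_body : runs B (input w v T)
    (Seq read (Seq double (Seq (window (WConst 0))
      (Seq descend (VSet 1 (WConst 0) (VGet 2 capE))))))
    (fun s => knapsack_max w v T (output s))
    (N.+1 * (cost read_body + 10) + (bits.+1 * 30 +
      (window_cost (WConst 0) * M ^ 2 +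
      (bits.+1 * (window_cost halfE * M ^ 2 + 20) +
        cost (VSet 1 (WConst 0) (VGet 2 capE))).+1).+1).+1).+1.
  apply: runs_seq; apply: runs_weaken runs_read _ (leqnn _).
  move=> s1 [p1 [t1 [regs_s1 table_s1]]].
  have [T_s1 M_s1 p_s1 t_s1] := regs_s1.
  apply: runs_seq.
  apply: runs_weaken (runs_double regs_s1 table_s1) _ (leqnn _).
  move=> s2 [regs_s2 table_s2]; apply: runs_seq.
  apply: (@runs_weaken _ _ _ _ _ _ (window_cost (WConst 0) * M ^ 2));
    first apply: (@runs_window (fun=> False) _ (fun=> 0)) regs_s2 table_s2 _ _.
  - by move=> s p t _ _; split=> //=; lia.
  - by [].
  - have T_small : T %/ 2 ^ bits = 0.
      by rewrite divn_small // ltnNge leq_exp_bits ltnn.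
    move=> F t near_t seeded_F _ dom_F; apply: splits_first_item => // u lt_ut.
    apply: dom_F => //; move: near_t; rewrite /near T_small; lia.
  - move=> s3 [t3 [regs_s3 table_s3 solved_s3]]; apply: runs_seq.
    apply: runs_weaken (runs_descend regs_s3 table_s3 solved_s3) _ (leqnn _).
    move=> s4 [t4 [[T_s4 M_s4 p_s4 t_s4] [sound_s4 _] solved_s4]].
    apply: runs_wp; rewrite /= T_s4; split; first by lia.
    rewrite /output /upd /=; split; first exact: sound_s4.
    by apply: solved_s4; rewrite /near divn1; lia.
  - exact: leqnn.
apply: runs_weaken; first apply: runs_if.
- by rewrite /=; lia.
- by rewrite /= N_gt0; apply: run_body.
- by [].
- move: (cost read_body) (window_cost _) (window_cost _) => r b a.
  have le_bits := bits_le.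
  set L := (trunc_log 2 T).+1 in le_bits *; set Y := maxn _ _.
  have M2_gt0 : 0 < M ^ 2 by rewrite expn_gt0 M_gt0.
  have L_gt0 : 0 < L by [].
  have le_NY : N.+1 <= Y by rewrite leq_maxl.
  have le_XY : M ^ 2 * L <= Y by rewrite leq_maxr.
  have le_LY : L <= Y by apply: leq_trans le_XY; rewrite leq_pmull.
  have le_MY : M ^ 2 <= Y by apply: leq_trans le_XY; rewrite leq_pmulr.
  have le_read := leq_mul le_NY (leqnn (r + 10)).
  have le_base := leq_mul (leqnn a) le_MY.
  have le_desc : bits.+1 * (b * M ^ 2 + 20) <= 2 * b * Y + 40 * Y.
    apply: (@leq_trans (2 * L * (b * M ^ 2 + 20))).
      by rewrite leq_mul2r; apply/orP; right; lia.
    have := leq_mul (leqnn (2 * b)) le_XY; nia.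
  move: (bits.+1 * (_ + 20)) (N.+1 * _) (a * M ^ 2) le_desc le_read le_base.
  move=> x y z le_x le_y le_z; rewrite /=; lia.
Qed.

End Correctness.

(* Time is O(max(N + 1, M^2 log T)) on words of O(log (N + M + T)) bits. The
   N + 1 is the time for reading the input; log T is read as
   floor (log2 T) + 1, the number of bits of T. *)
Theorem theorem2 :
  exists (P : cmd) (C k : nat),
  forall (R : realDomainType) (N : nat) (w : 'I_N -> nat) (v : 'I_N -> R)
         (T : nat),
  (forall i : 'I_N, 0 < w i) ->
  let M := max_weight w in
  exists (s : state R) (t : nat),
    [/\ exec ((N + M + T + 2) ^ k) (input w v T) P s t,
        knapsack_max w v T (output s)
      & t <= C * maxn N.+1 (M ^ 2 * (trunc_log 2 T).+1)].
Proof.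
exists knapsack.
exists (cost read_body + 200 + window_cost (WConst 0) + 2 * window_cost halfE).
exists 3 => R N w v T w_gt0 M.
have [N_gt0|] := ltnP 0 N.
  apply: runs_knapsack => //; rewrite expnSr leq_mul2r; apply/orP; right.
  by have := max_weight_gt0 w_gt0 N_gt0; rewrite -/M; nia.
rewrite leqn0 => /eqP N0; subst N.
have B_gt0 : 0 < (0 + M + T + 2) ^ 3 by rewrite expn_gt0 addn2.
have empty (m : 'I_0 -> nat) : total_value v m = 0%R.
  by rewrite /total_value big_ord0.
apply: (@runs_weaken _ _ _ _ (fun s => s = input w v T) _
  (tcost (WLt (WConst 0) nE) + 1).+1).
- apply: runs_if; first by rewrite /= B_gt0.
  by exists (input w v T), 1; split=> //; apply: ExecSkip.
- move=> _ ->; rewrite /output /=; split; last by move=> m _; rewrite empty.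
  by exists (fun=> 0); rewrite ?empty // /total_weight big_ord0.
- by rewrite /=; have := leq_maxl 1 (M ^ 2 * (trunc_log 2 T).+1); nia.
Qed.
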